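(* Let $A$ be a (not necessarily commutative) ring, let $X=\{x_1,\dots,x_\mu\}$ be a finite set, and let $F_\mu$ be the free group on generators $z_1,\dots,z_\mu$. Let $\Sigma$ be the set of matrices over $A\langle X\rangle$ which become invertible under $\epsilon:A\langle X\rangle\to A$, $x_i\mapsto0$ for all $i$, and let $\Psi$ be the set of square matrices $M$ over the group ring $AF_\mu$ such that $\epsilon(M)$ is invertible, where $\epsilon:AF_\mu\to A$, $z_i\mapsto1$ for all $i$. Then the ring homomorphism $$m:\Sigma^{-1}A\langle X\rangle\to\Psi^{-1}AF_\mu$$ induced by $m:A\langle X\rangle\to AF_\mu$, $x_i\mapsto z_i-1$ for all $i$, is an isomorphism.
   Context: Rings are associative with $1$. $A\langle X\rangle=A\otimes_{\mathbb{Z}}\mathbb{Z}\langle X\rangle$ is the free $A$-algebra on the non-commuting indeterminates $x_1,\dots,x_\mu$, in which the elements of $A$ commute with the $x_i$. In the group ring $AF_\mu$ the elements of $F_\mu$ commute with the elements of $A$. The homomorphisms $\epsilon$ and $m$ restrict to the identity on $A$. Cohn localization: for a set $\Sigma$ of matrices over a ring $R$, a ring homomorphism $R\to B$ is $\Sigma$-inverting if every matrix in $\Sigma$ is mapped to an invertible matrix over $B$; $i_\Sigma:R\to\Sigma^{-1}R$ is the universal $\Sigma$-inverting homomorphism, i.e. it is $\Sigma$-inverting and every $\Sigma$-inverting homomorphism $R\to B$ factors uniquely through $i_\Sigma$. Since $\epsilon\circ m=\epsilon:A\langle X\rangle\to A$, the composite $i_\Psi\circ m:A\langle X\rangle\to\Psi^{-1}AF_\mu$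 is $\Sigma$-inverting; the induced map, also denoted $m$, is the unique ring homomorphism $\Sigma^{-1}A\langle X\rangle\to\Psi^{-1}AF_\mu$ satisfying $m\circ i_\Sigma=i_\Psi\circ m$. *)

(* Defs.v *)
From HB Require Import structures.
From mathcomp Require Import all_boot all_algebra finmap.
From mathcomp.multinomials Require Import monalg.

Set Implicit Arguments.
Unset Strict Implicit.
Unset Printing Implicit Defensive.

Import GRing.Theory.

Local Open Scope fset_scope.
Local Open Scope ring_scope.

(* Rings are pzRingTypes rather than nzRingTypes so that the zero ring is      *)
(* allowed. A<X> and A[F_n] are both monoid rings, in which the coefficients  *)
(* commute with the monoid; mring_mon a k is the monomial a k. The monalg      *)
(* library has a product on {malg A[M]} only for a nontrivial A and a monoid  *)
(* M without nontrivial units, which excludes groups, so only its additive    *)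
(* structure is used here.                                                    *)
Definition monoid_ring (A : pzRingType) (M : monoidType) : Type := {malg A[M]}.
HB.instance Definition _ A M := GRing.Zmodule.on (monoid_ring A M).

(* The operations are locked: unification otherwise unfolds finite maps. *)
HB.lock Definition mring_mon (A : pzRingType) (M : monoidType) (a : A) (k : M) :
  monoid_ring A M := << a *g k >>.

HB.lock Definition mring_mul (A : pzRingType) (M : monoidType)
    (f g : monoid_ring A M) : monoid_ring A M :=
  \sum_(k <- msupp f) \sum_(l <- msupp g) mring_mon (f@_k * g@_l) (k * l)%g.

HB.lock Definition mring_ext (A B : pzRingType) (M : monoidType) (f : A -> B)
    (h : M -> B) (g : monoid_ring A M) : B :=
  \sum_(k <- msupp g) f g@_k * h k.

Arguments mring_mon {A M}.
Arguments mring_mul {A M}.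
Arguments mring_ext {A B M}.

Section MonoidRing.
Variables (A : pzRingType) (M : monoidType).

Local Notation monoid_ring := (monoid_ring A M).

Local Notation mul := (@mring_mul A M).

Implicit Types (a b : A) (k l : M) (f g h : monoid_ring).

Definition mring_one : monoid_ring := mring_mon 1 1%g.

Lemma mring_monE (a : A) (k : M) : mring_mon a k = << a *g k >>.
Proof. by rewrite mring_mon.unlock. Qed.

Lemma mring_mon_is_zmod_morphism (k : M) :
  zmod_morphism (fun a : A => mring_mon a k).
Proof. by move=> a b; rewrite !mring_monE monalgUB. Qed.

Lemma mring_mon0 (k : M) : mring_mon 0 k = 0 :> monoid_ring.
Proof. by rewrite mring_monE monalgU0. Qed.

Lemma mring_monD a b (k : M) :
  mring_mon (a + b) k = mring_mon a k + mring_mon b k :> monoid_ring.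
Proof. by rewrite !mring_monE monalgUD. Qed.

Lemma mring_mulEw (d1 d2 : {fset M}) f g :
  msupp f `<=` d1 -> msupp g `<=` d2 ->
  mring_mul f g =
    \sum_(k <- d1) \sum_(l <- d2) mring_mon (f@_k * g@_l) (k * l)%g.
Proof.
move=> le1 le2; rewrite mring_mul.unlock (big_fset_incl _ le1) /=.
  apply/eq_bigr=> k _; apply/big_fset_incl => // l _ /mcoeff_outdom ->.
  by rewrite mulr0 mring_mon0.
move=> k _ /mcoeff_outdom fk.
by rewrite big1 // => l _; rewrite fk mul0r mring_mon0.
Qed.

Lemma mring_mulDl : left_distributive mul +%R.
Proof.
move=> f1 f2 g; rewrite (mring_mulEw (msuppD_le f1 f2) (fsubset_refl _)).
rewrite (mring_mulEw (fsubsetUl _ (msupp f2)) (fsubset_refl (msupp g))).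
rewrite (mring_mulEw (fsubsetUr (msupp f1) _) (fsubset_refl (msupp g))).
rewrite -big_split /=; apply/eq_bigr=> k _.
rewrite -big_split /=; apply/eq_bigr=> l _.
by rewrite mcoeffD mulrDl mring_monD.
Qed.

Lemma mring_mulDr : right_distributive mul +%R.
Proof.
move=> g f1 f2; rewrite (mring_mulEw (fsubset_refl _) (msuppD_le f1 f2)).
rewrite (mring_mulEw (fsubset_refl (msupp g)) (fsubsetUl _ (msupp f2))).
rewrite (mring_mulEw (fsubset_refl (msupp g)) (fsubsetUr (msupp f1) _)).
rewrite -big_split /=; apply/eq_bigr=> k _.
rewrite -big_split /=; apply/eq_bigr=> l _.
by rewrite mcoeffD mulrDr mring_monD.
Qed.

Lemma mring_mul0g : left_zero (0 : monoid_ring) mul.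
Proof. by move=> g; rewrite mring_mul.unlock msupp0 big_seq_fset0. Qed.

Lemma mring_mulg0 : right_zero (0 : monoid_ring) mul.
Proof.
move=> g; rewrite mring_mul.unlock big1 // => k _.
by rewrite msupp0 big_seq_fset0.
Qed.

Lemma mring_mulUU a b k l :
  mring_mul (mring_mon a k) (mring_mon b l) = mring_mon (a * b) (k * l)%g.
Proof.
rewrite [mring_mon a k]mring_monE [mring_mon b l]mring_monE.
by rewrite (mring_mulEw msuppU_le msuppU_le) !big_seq_fset1 !mcoeffUU.
Qed.

Lemma mring_ind (P : monoid_ring -> Prop) :
  P 0 -> (forall f g, P f -> P g -> P (f + g)) ->
  (forall (a : A) (k : M), P (mring_mon a k)) -> forall f, P f.
Proof.
move=> P0 PD PU f; rewrite [f]monalgE; apply: big_ind => // k _.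
by rewrite -mring_monE.
Qed.

Lemma mring_mulA : associative mul.
Proof.
move=> f g h; elim/mring_ind: f => [|f1 f2 IH1 IH2|a k].
- by rewrite !mring_mul0g.
- by rewrite !mring_mulDl IH1 IH2.
elim/mring_ind: g => [|g1 g2 IH1 IH2|b l].
- by rewrite !(mring_mul0g, mring_mulg0).
- by rewrite mring_mulDl !mring_mulDr mring_mulDl IH1 IH2.
elim/mring_ind: h => [|h1 h2 IH1 IH2|c m].
- by rewrite !mring_mulg0.
- by rewrite !mring_mulDr IH1 IH2.
by rewrite !mring_mulUU mulrA mulgA.
Qed.

Lemma mring_mul1g : left_id mring_one mul.
Proof.
elim/mring_ind => [|g1 g2 IH1 IH2|b l]; first exact: mring_mulg0.
  by rewrite mring_mulDr IH1 IH2.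
by rewrite mring_mulUU mul1r mul1g.
Qed.

Lemma mring_mulg1 : right_id mring_one mul.
Proof.
elim/mring_ind => [|g1 g2 IH1 IH2|b l]; first exact: mring_mul0g.
  by rewrite mring_mulDl IH1 IH2.
by rewrite mring_mulUU mulr1 mulg1.
Qed.

HB.instance Definition _ := GRing.Zmodule_isPzRing.Build monoid_ring
  mring_mulA mring_mul1g mring_mulg1 mring_mulDl mring_mulDr.

Lemma mringMUU a b k l :
  (mring_mon a k : monoid_ring) * mring_mon b l = mring_mon (a * b) (k * l)%g.
Proof. exact: mring_mulUU. Qed.

Definition mringC (a : A) : monoid_ring := mring_mon a 1%g.

Lemma mringC_comm a k : GRing.comm (mringC a) (mring_mon 1 k).
Proof. by rewrite /GRing.comm !mringMUU mulr1 mul1r mulg1 mul1g. Qed.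

Lemma mringC_is_zmod_morphism : zmod_morphism mringC.
Proof. exact: mring_mon_is_zmod_morphism. Qed.

Lemma mringC_is_monoid_morphism : monoid_morphism mringC.
Proof. by split=> // a b; rewrite mringMUU mulg1. Qed.

HB.instance Definition _ :=
  GRing.isZmodMorphism.Build A monoid_ring mringC mringC_is_zmod_morphism.
HB.instance Definition _ :=
  GRing.isMonoidMorphism.Build A monoid_ring mringC mringC_is_monoid_morphism.

End MonoidRing.

Section MonoidRingExtension.
Variables (A B : pzRingType) (M : monoidType).

Variables (f : {rmorphism A -> B}) (h : M -> B).

Lemma mring_extEw (d : {fset M}) g : msupp g `<=` d ->
  mring_ext f h g = \sum_(k <- d) f g@_k * h k.
Proof.
move=> le; rewrite mring_ext.unlock (big_fset_incl _ le) //= => k _.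
by move=> /mcoeff_outdom ->; rewrite rmorph0 mul0r.
Qed.

Lemma mring_extU (a : A) (k : M) : mring_ext f h (mring_mon a k) = f a * h k.
Proof.
by rewrite mring_monE (mring_extEw msuppU_le) big_seq_fset1 mcoeffUU.
Qed.

Lemma mring_extB : zmod_morphism (mring_ext f h).
Proof.
move=> g1 g2; rewrite (mring_extEw (msuppB_le g1 g2)).
rewrite (mring_extEw (fsubsetUl _ (msupp g2))).
rewrite (mring_extEw (fsubsetUr (msupp g1) _)) -sumrB.
by apply/eq_bigr=> k _; rewrite mcoeffB rmorphB mulrBl.
Qed.

Hypotheses (h1 : h 1%g = 1) (hM : forall k l, h (k * l)%g = h k * h l).
Hypothesis fhC : forall a k, GRing.comm (f a) (h k).

Lemma mring_extM : monoid_morphism (mring_ext f h).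
Proof.
have E0 : mring_ext f h 0 = 0 by rewrite mring_ext.unlock msupp0 big_seq_fset0.
have D g1 g2 : mring_ext f h (g1 + g2) = mring_ext f h g1 + mring_ext f h g2.
  have -> : g1 + g2 = g1 - (0 - g2) by rewrite sub0r opprK.
  by rewrite !mring_extB E0 sub0r opprK.
split; first by rewrite mring_extU rmorph1 mul1r.
move=> g1 g2; elim/mring_ind: g1 => [|g g' IH IH'|a k].
- by rewrite mul0r E0 mul0r.
- by rewrite mulrDl !D IH IH' mulrDl.
elim/mring_ind: g2 => [|g g' IH IH'|b l].
- by rewrite mulr0 E0 mulr0.
- by rewrite mulrDr !D IH IH' mulrDr.
rewrite mringMUU !mring_extU rmorphM hM -!mulrA; congr (_ * _).
by rewrite !mulrA fhC.
Qed.

End MonoidRingExtension.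

Definition free_monoid (n : nat) : Type := seq 'I_n.
HB.instance Definition _ n := Choice.on (free_monoid n).
HB.instance Definition _ n :=
  isMonoid.Build (free_monoid n) (@catA 'I_n) (@cat0s 'I_n) (@cats0 'I_n).

Notation free_alg A n := (monoid_ring A (free_monoid n)).

Definition free_alg_var (A : pzRingType) n (i : 'I_n) : free_alg A n :=
  mring_mon 1 ([:: i] : free_monoid n).

(* Letters: (i, true) stands for z_i and (i, false) for its inverse. *)
Section FreeGroup.
Variable n : nat.

Definition letter : Type := 'I_n * bool.
HB.instance Definition _ := Choice.on letter.

Implicit Types (a b : letter) (u v w : seq letter).

Definition letterV a : letter := (a.1, ~~ a.2).

Definition reduced w := sorted (fun a b => b != letterV a) w.

Record free_group : Type := FreeGroup {
  fg_word : seq letter;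
  fg_reduced : reduced fg_word
}.

HB.instance Definition _ := [isSub for fg_word].
HB.instance Definition _ := [Choice of free_group by <:].

Lemma letterVK : involutive letterV.
Proof. by case=> i b; rewrite /letterV /= negbK. Qed.

(* The reduced form of a :: w, for w reduced. *)
Definition push a w :=
  if w is b :: w' then if b == letterV a then w' else a :: w else [:: a].

Lemma push_reduced a w : reduced w -> reduced (push a w).
Proof.
case: w => [|b w] //= bw; case: ifPn => [_|ba]; last by rewrite /= ba.
exact: path_sorted bw.
Qed.

Lemma pushK a w : reduced w -> push a (push (letterV a) w) = w.
Proof.
case: w => [|b w] /=; first by rewrite eqxx.
rewrite letterVK; case: eqP => [-> |_ _] /=; last by rewrite eqxx.
by case: w => [|c w] //= /andP[/negPf ->].
Qed.

Lemma foldr_push_reduced u w : reduced w -> reduced (foldr push w u).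
Proof. by move=> wr; elim: u => //= a u; apply: push_reduced. Qed.

Lemma foldr_push u w a :
  reduced w -> foldr push w (push a u) = push a (foldr push w u).
Proof.
move=> wr; case: u => [|b u] //=; case: eqP => [->|] //=.
by rewrite pushK // foldr_push_reduced.
Qed.

Lemma wordV_reduced w : reduced w -> reduced (rev (map letterV w)).
Proof.
rewrite /reduced rev_sorted; elim: w => [|a [|b w] IH] //= /andP[ba bw].
apply/andP; split; last exact: IH.
by rewrite letterVK; apply: contraNneq ba => <-.
Qed.

Definition fg_one : free_group := @FreeGroup [::] isT.
Definition fg_mul (u v : free_group) : free_group :=
  FreeGroup (foldr_push_reduced (fg_word u) (fg_reduced v)).
Definition fg_inv (u : free_group) : free_group :=
  FreeGroup (wordV_reduced (fg_reduced u)).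

Lemma fg_mulA : associative fg_mul.
Proof.
move=> [u ur] [v vr] [w wr]; apply/val_inj => /= {ur vr}.
by elim: u => //= a u ->; rewrite foldr_push.
Qed.

Lemma fg_mul1g : left_id fg_one fg_mul.
Proof. by move=> u; apply/val_inj. Qed.

Lemma fg_mulg1 : right_id fg_one fg_mul.
Proof.
move=> [u ur]; apply/val_inj => /=; elim: u ur => //= a u IH au.
rewrite (IH (path_sorted au)).
by case: u au {IH} => //= b u /andP[/negPf->].
Qed.

Lemma fg_mulVg : left_inverse fg_one fg_inv fg_mul.
Proof.
move=> [u ur]; apply/val_inj => /= {ur}; elim: u => //= a u IH.
by rewrite rev_cons foldr_rcons /= letterVK eqxx.
Qed.

Lemma fg_mulgV : right_inverse fg_one fg_inv fg_mul.
Proof.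
move=> u; have uK : fg_inv (fg_inv u) = u.
  by apply/val_inj; rewrite /= map_rev revK (mapK letterVK).
by rewrite -[X in fg_mul X]uK fg_mulVg.
Qed.

HB.instance Definition _ := isGroup.Build free_group
  fg_mulA fg_mul1g fg_mulg1 fg_mulVg fg_mulgV.

Definition fg_gen (i : 'I_n) : free_group := @FreeGroup [:: (i, true)] isT.

End FreeGroup.

Notation free_group_ring A n := (monoid_ring A (free_group n)).

Definition fgr_gen (A : pzRingType) n (i : 'I_n) : free_group_ring A n :=
  mring_mon 1 (fg_gen i).

Definition free_alg_ext (A B : pzRingType) n (f : A -> B) (b : 'I_n -> B) :
    free_alg A n -> B :=
  mring_ext f (fun w : free_monoid n => \prod_(i <- w) b i).

Section Maps.
Variables (A : pzRingType) (n : nat).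

Definition free_alg_eps : free_alg A n -> A := free_alg_ext idfun (fun=> 0).

Definition free_group_ring_eps : free_group_ring A n -> A :=
  mring_ext idfun (fun=> 1).

Definition magnus_map : free_alg A n -> free_group_ring A n :=
  free_alg_ext (@mringC A (free_group n)) (fun i => fgr_gen A i - 1).

Lemma free_alg_extM (B : pzRingType) (f : {rmorphism A -> B}) (b : 'I_n -> B) :
  (forall a i, GRing.comm (f a) (b i)) ->
  monoid_morphism (free_alg_ext f b).
Proof.
move=> fbC; apply: mring_extM => [|k l|a k]; first by rewrite big_nil.
  by rewrite big_cat.
by elim/big_rec: _ => [|i x _ IH]; [exact: commr1|exact: commrM].
Qed.

HB.instance Definition _ := GRing.isZmodMorphism.Build (free_alg A n) A
  free_alg_eps (mring_extB _ _).
HB.instance Definition _ := GRing.isMonoidMorphism.Build (free_alg A n) A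
  free_alg_eps (free_alg_extM (f := idfun) (fun a _ => commr0 a)).

Fact free_group_ring_epsM : monoid_morphism free_group_ring_eps.
Proof.
by apply: (mring_extM (f := idfun)) => [|k l|a k] //;
  [rewrite mulr1 | exact: commr1].
Qed.

HB.instance Definition _ := GRing.isZmodMorphism.Build (free_group_ring A n) A
  free_group_ring_eps (mring_extB _ _).
HB.instance Definition _ := GRing.isMonoidMorphism.Build (free_group_ring A n) A
  free_group_ring_eps free_group_ring_epsM.

Fact magnus_mapM : monoid_morphism magnus_map.
Proof.
apply: free_alg_extM => a i; apply: commrB; last exact: commr1.
exact: mringC_comm.
Qed.

HB.instance Definition _ :=
  GRing.isZmodMorphism.Build (free_alg A n) (free_group_ring A n)
    magnus_map (mring_extB _ _).
HB.instance Definition _ :=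
  GRing.isMonoidMorphism.Build (free_alg A n) (free_group_ring A n)
    magnus_map magnus_mapM.

Lemma free_alg_epsC a : free_alg_eps (mringC _ a) = a.
Proof. by rewrite [LHS](mring_extU idfun) big_nil mulr1. Qed.

Lemma free_alg_epsX i : free_alg_eps (free_alg_var A i) = 0.
Proof. by rewrite [LHS](mring_extU idfun) big_seq1 mulr0. Qed.

Lemma free_group_ring_epsC a : free_group_ring_eps (mringC _ a) = a.
Proof. by rewrite [LHS](mring_extU idfun) mulr1. Qed.

Lemma free_group_ring_epsZ i : free_group_ring_eps (fgr_gen A i) = 1.
Proof. by rewrite [LHS](mring_extU idfun) mulr1. Qed.

Lemma magnus_mapC a : magnus_map (mringC _ a) = mringC _ a.
Proof. by rewrite [LHS]mring_extU big_nil mulr1. Qed.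

Lemma magnus_mapX i : magnus_map (free_alg_var A i) = fgr_gen A i - 1.
Proof. by rewrite [LHS]mring_extU big_seq1 rmorph1 mul1r. Qed.

Lemma free_group_ring_eps_magnus p :
  free_group_ring_eps (magnus_map p) = free_alg_eps p.
Proof.
elim/mring_ind: p => [|x y Hx Hy|a w]; first by rewrite !rmorph0.
  by rewrite !rmorphD /= Hx Hy.
have -> : magnus_map (mring_mon a w : free_alg A n) =
    mringC _ a * \prod_(i <- w) (fgr_gen A i - 1) by exact: mring_extU.
have -> : free_alg_eps (mring_mon a w : free_alg A n) = a * \prod_(i <- w) 0.
  exact: (mring_extU idfun).
rewrite rmorphM /= free_group_ring_epsC; congr (_ * _).
rewrite rmorph_prod; apply: eq_bigr => i _.
by rewrite rmorphB rmorph1 /= free_group_ring_epsZ subrr.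
Qed.

End Maps.

(* Matrices may be rectangular: over a ring without invariant basis number a  *)
(* rectangular matrix can have a two-sided inverse.                           *)
Definition mx_invertible (R : pzRingType) m n (M : 'M[R]_(m, n)) : Prop :=
  exists N : 'M[R]_(n, m), M *m N = 1%:M /\ N *m M = 1%:M.

Definition mx_set (R : pzRingType) : Type := forall m n, 'M[R]_(m, n) -> Prop.

Definition mx_inverting (R B : pzRingType) (S : mx_set R) (f : R -> B) : Prop :=
  forall m n (M : 'M[R]_(m, n)), S m n M -> mx_invertible (map_mx f M).

Record is_cohn_localization (R : pzRingType) (S : mx_set R) (L : pzRingType)
    (i : {rmorphism R -> L}) : Prop := CohnLocalization {
  cohn_inverting : mx_inverting S i;
  cohn_universal : forall (B : pzRingType) (f : {rmorphism R -> B}),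
    mx_inverting S f ->
    exists g : {rmorphism L -> B},
      (forall r, g (i r) = f r) /\
      (forall g' : {rmorphism L -> B}, (forall r, g' (i r) = f r) -> g' =1 g)
}.

Definition Sigma_set (A : pzRingType) (n : nat) : mx_set (free_alg A n) :=
  fun p q M => mx_invertible (map_mx (@free_alg_eps A n) M).

Definition Psi_set (A : pzRingType) (n : nat) : mx_set (free_group_ring A n) :=
  fun p q M => p = q /\ mx_invertible (map_mx (@free_group_ring_eps A n) M).

(* Main.v *)
Require Import Defs.
From HB Require Import structures.
From mathcomp Require Import all_boot all_algebra.

Set Implicit Arguments.
Unset Strict Implicit.
Unset Printing Implicit Defensive.

Import GRing.Theory.
Local Open Scope ring_scope.

(** The inverse of the induced map is constructed from the universal properties
of the two localizations. Write i for the universal map of the free algebra and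
L for its target.

The induced map exists because the Magnus map is compatible with the
augmentations ([magnus_inverting]). As matrices over the free algebra may be
rectangular while those over the group ring are square, a rectangular matrix M
with inverse N modulo the augmentation is handled through the square products
M N and N M, where N is lifted to the free algebra with entries in A.

Conversely, 1 + x_j has augmentation 1, so it becomes a unit of L commuting with
A, and z_j |-> 1 + x_j defines a homomorphism k from the group ring to L
([magnus_extension]). The whole weight of the proof is in showing that k inverts
every matrix with invertible augmentation ([magnus_extension_inverting]), since
such a matrix need not come from the free algebra. The remedy is the
linearization trick of Higman and Cohn: say that a matrix over L is rational
when it has the form c + f s^-1 g, where c, f, s, g are matrices over the free
algebra and the augmentation of s is invertible. Rational matrices are closed
under sums and products and contain the images of 1 + x_j and their inverses, so
all matrices over the image of k are rational. Now c + f s^-1 g is a Schur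
complement in the block matrix with rows (c, f) and (- g, s); over any ring in
which s is invertible, the one is invertible if and only if the other is. If the
augmentation of c + f s^-1 g is invertible, so is that of the block matrix; the
block matrix is over the free algebra, hence becomes invertible over L; hence
c + f s^-1 g is invertible over L ([rational_invertible]).

So k extends to the localized group ring. The two composites of this extension
with the induced map fix the images of the generators, and so are the identity
by the uniqueness half of the universal properties. *)

(** * Invertible matrices over a ring *)

Section Invertible.
Variable R : pzRingType.

Lemma mx_invertible1 n : mx_invertible (1%:M : 'M[R]_n).
Proof. by exists 1%:M; rewrite mulmx1. Qed.

Lemma mx_invertible_lr m n (M : 'M[R]_(m, n)) (N N' : 'M[R]_(n, m)) :
  M *m N = 1%:M -> N' *m M = 1%:M -> mx_invertible M.
Proof.
move=> MN N'M; exists N; split=> //.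
suff -> : N = N' by [].
by rewrite -[N]mul1mx -N'M -mulmxA MN mulmx1.
Qed.

Lemma mx_invertibleM m n p (M : 'M[R]_(m, n)) (N : 'M[R]_(n, p)) :
  mx_invertible M -> mx_invertible N -> mx_invertible (M *m N).
Proof.
move=> [M' [MM' M'M]] [N' [NN' N'N]]; exists (N' *m M'); split.
  by rewrite mulmxA -(mulmxA M) NN' mulmx1.
by rewrite mulmxA -(mulmxA N') M'M mulmx1.
Qed.

Lemma mx_invertible_scalar (a b : R) :
  a * b = 1 -> b * a = 1 -> mx_invertible (a%:M : 'M_1).
Proof. by move=> ab ba; exists b%:M; rewrite -!scalar_mxM ab ba. Qed.

Lemma mx_invertible_ublock m n p q (M : 'M[R]_(m, n)) (N : 'M[R]_(p, q))
    (U : 'M[R]_(m, q)) :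
  mx_invertible M -> mx_invertible N -> mx_invertible (block_mx M U 0 N).
Proof.
move=> [M' [MM' M'M]] [N' [NN' N'N]].
exists (block_mx M' (- (M' *m U *m N')) 0 N').
rewrite !mulmx_block !(mulmx0, mul0mx, addr0, add0r) MM' M'M NN' N'N.
rewrite mulmxN !mulNmx !mulmxA MM' mul1mx -[in X in _ /\ X]mulmxA N'N mulmx1.
by rewrite addNr subrr -!scalar_mx_block.
Qed.

Lemma mx_invertible_lblock1 m n (U : 'M[R]_(m, n)) :
  mx_invertible (block_mx 1%:M 0 U 1%:M).
Proof.
exists (block_mx 1%:M 0 (- U) 1%:M).
rewrite !mulmx_block !(mulmx0, mul0mx, mulmx1, mul1mx, addr0, add0r).
by rewrite addNr subrr -!scalar_mx_block.
Qed.

Lemma mx_invertible_diag m n p (M : 'M[R]_(m, n)) (s : 'M[R]_p) :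
  mx_invertible (block_mx M 0 0 s) -> mx_invertible M.
Proof.
move=> [N]; rewrite -[N]submxK !mulmx_block !(mulmx0, mul0mx, addr0, add0r).
rewrite !(scalar_mx_block _ p) => -[/eq_block_mx[MN _ _ _] /eq_block_mx[NM _ _ _]].
by exists (ulsubmx N).
Qed.

Section Schur.
Variables (p q n : nat) (c : 'M[R]_(p, q)) (f : 'M[R]_(p, n)) (g : 'M[R]_(n, q)).
Variables (s t : 'M[R]_n).
Hypotheses (st : s *m t = 1%:M) (ts : t *m s = 1%:M).

Lemma schur_factor :
  block_mx c f (- g) s = block_mx 1%:M (f *m t) 0 1%:M
    *m (block_mx (c + f *m t *m g) 0 0 s *m block_mx 1%:M 0 (- (t *m g)) 1%:M).
Proof.
rewrite !mulmx_block !(mulmx0, mul0mx, mulmx1, mul1mx, addr0, add0r).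
by rewrite !mulmxN !mulmxA st mul1mx -(mulmxA f t s) ts mulmx1 addrK.
Qed.

Lemma schur_factorV :
  block_mx (c + f *m t *m g) 0 0 s = block_mx 1%:M (- (f *m t)) 0 1%:M
    *m (block_mx c f (- g) s *m block_mx 1%:M 0 (t *m g) 1%:M).
Proof.
rewrite !mulmx_block !(mulmx0, mul0mx, mulmx1, mul1mx, addr0, add0r).
by rewrite !mulmxA st mul1mx addNr mulmx0 addr0 mulNmx -(mulmxA f t s) ts mulmx1 subrr.
Qed.

(** Block elimination with pivot s relates both matrices by invertible
triangular factors, up to the invertible summand s. *)
Lemma mx_invertible_schur :
  mx_invertible (block_mx c f (- g) s) <-> mx_invertible (c + f *m t *m g).
Proof.
have inv1 := mx_invertible1; have invs : mx_invertible s by exists t.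
split=> inv.
  apply: (@mx_invertible_diag _ _ n _ s); rewrite schur_factorV.
  apply: mx_invertibleM; first exact: mx_invertible_ublock.
  by apply: mx_invertibleM => //; apply: mx_invertible_lblock1.
rewrite schur_factor; apply: mx_invertibleM; first exact: mx_invertible_ublock.
apply: mx_invertibleM; last exact: mx_invertible_lblock1.
exact: mx_invertible_ublock.
Qed.

End Schur.

End Invertible.

(** * Rational matrices over a localization *)

Section Rational.
Variables (R A L : pzRingType) (eps : {rmorphism R -> A}).
Variable i : {rmorphism R -> L}.

Definition eps_invertible : mx_set R :=
  fun m n M => mx_invertible (map_mx eps M).

(** The fractions c + f s^-1 g with s invertible under the augmentation eps; t
plays the part of s^-1. Denominators are square matrices of any size because
sums and products of fractions over a noncommutative ring have no common
denominator of the size of their terms. *)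
Definition rational p q (Q : 'M[L]_(p, q)) : Prop :=
  exists n (c : 'M[R]_(p, q)) (f : 'M[R]_(p, n)) (s : 'M[R]_n)
         (g : 'M[R]_(n, q)) (t : 'M[L]_n),
  [/\ eps_invertible s, map_mx i s *m t = 1%:M, t *m map_mx i s = 1%:M
    & Q = map_mx i c + map_mx i f *m t *m map_mx i g].

Lemma rational_map p q (c : 'M[R]_(p, q)) : rational (map_mx i c).
Proof.
exists 0%N, c, 0, 1%:M, 0, 1%:M; split; rewrite ?map_mx1 ?mulmx1 //.
  by rewrite /eps_invertible map_mx1; apply: mx_invertible1.
by rewrite !map_mx0 mulmx0 addr0.
Qed.

Lemma rationalD p q (Q Q' : 'M[L]_(p, q)) :
  rational Q -> rational Q' -> rational (Q + Q').
Proof.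
move=> [n [c [f [s [g [t [es st ts ->]]]]]]].
move=> [n' [c' [f' [s' [g' [t' [es' st' ts' ->]]]]]]].
exists (n + n')%N, (c + c'), (row_mx f f'), (block_mx s 0 0 s'), (col_mx g g').
exists (block_mx t 0 0 t'); split.
- by rewrite /eps_invertible map_block_mx !map_mx0; apply: mx_invertible_ublock.
- rewrite map_block_mx !map_mx0 mulmx_block !(mulmx0, mul0mx, addr0, add0r).
  by rewrite st st' -scalar_mx_block.
- rewrite map_block_mx !map_mx0 mulmx_block !(mulmx0, mul0mx, addr0, add0r).
  by rewrite ts ts' -scalar_mx_block.
rewrite map_row_mx map_col_mx mul_row_block mul_row_col map_mxD.
by rewrite !(mulmx0, addr0, add0r) addrACA.
Qed.

(** The product is realized by the denominator with rows (s, - g f') and (0, s'):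
the upper right block s^-1 g f' s'^-1 of its inverse yields the cross term
f s^-1 g f' s'^-1 g'. *)
Lemma rationalM p q r (Q : 'M[L]_(p, q)) (Q' : 'M[L]_(q, r)) :
  rational Q -> rational Q' -> rational (Q *m Q').
Proof.
move=> [n [c [f [s [g [t [es st ts ->]]]]]]].
move=> [n' [c' [f' [s' [g' [t' [es' st' ts' ->]]]]]]].
exists (n + n')%N, (c *m c'), (row_mx f (c *m f')).
exists (block_mx s (- (g *m f')) 0 s'), (col_mx (g *m c') g').
exists (block_mx t (t *m map_mx i (g *m f') *m t') 0 t'); split.
- by rewrite /eps_invertible map_block_mx !map_mx0; apply: mx_invertible_ublock.
- rewrite map_block_mx map_mx0 mulmx_block !(mulmx0, mul0mx, addr0, add0r).
  rewrite st st' map_mxN mulNmx !mulmxA st mul1mx subrr.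
  by rewrite -scalar_mx_block.
- rewrite map_block_mx map_mx0 mulmx_block !(mulmx0, mul0mx, addr0, add0r).
  rewrite ts ts' map_mxN mulmxN -!mulmxA ts' mulmx1 addNr.
  by rewrite -scalar_mx_block.
rewrite map_row_mx map_col_mx mul_row_block mul_row_col !map_mxM.
rewrite !(mulmx0, addr0) !(mulmxDl, mulmxDr) !mulmxA.
by rewrite -!addrA; congr (_ + _); rewrite addrCA; congr (_ + _); rewrite addrC.
Qed.

(** A matrix is the sum of its entries multiplied on both sides by matrix units,
which come from R. *)
Lemma rational_entries p q (Q : 'M[L]_(p, q)) :
  (forall j k, rational ((Q j k)%:M : 'M_1)) -> rational Q.
Proof.
move=> ratQ.
have rat_sum (I : finType) (F : I -> 'M[L]_(p, q)) :
    (forall j, rational (F j)) -> rational (\sum_j F j).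
  move=> ratF; apply: big_ind => [||j _]; last exact: ratF.
    by rewrite -(map_mx0 i); apply: rational_map.
  by move=> Q1 Q2; apply: rationalD.
rewrite [Q]matrix_sum_delta; apply: (rat_sum 'I_p) => j; apply: (rat_sum 'I_q) => k.
have -> : Q j k *: delta_mx j k =
    map_mx i (delta_mx j 0 : 'cV_p) *m (Q j k)%:M *m map_mx i (delta_mx 0 k).
  apply/matrixP=> j' k'; rewrite !(mxE, big_ord1) !eqxx !andbT !mulr1n /=.
  rewrite !rmorph_nat.
  by case: (j' == j); case: (k' == k); rewrite ?(mulr0, mul0r, mulr1, mul1r).
apply: rationalM; last exact: rational_map.
by apply: rationalM => //; apply: rational_map.
Qed.

Lemma rationalV (a : R) (v : L) :
  (exists b, eps a * b = 1 /\ b * eps a = 1) ->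
  i a * v = 1 -> v * i a = 1 -> rational (v%:M : 'M_1).
Proof.
move=> [b [ab ba]] av va; exists 1%N, 0, 1%:M, a%:M, 1%:M, v%:M.
split.
- by rewrite /eps_invertible map_scalar_mx; apply: mx_invertible_scalar ab ba.
- by rewrite map_scalar_mx -scalar_mxM av.
- by rewrite map_scalar_mx -scalar_mxM va.
by rewrite map_mx0 add0r !map_mx1 mul1mx mulmx1.
Qed.

(** The block matrix with rows (c, f) and (- g, s) is defined over R, where
invertibility under eps suffices; Schur complements over A and over L carry the
invertibility from the augmentation of Q to Q. *)
Lemma rational_invertible (epsL : {rmorphism L -> A}) p q (Q : 'M[L]_(p, q)) :
  mx_inverting eps_invertible i -> (forall r, epsL (i r) = eps r) ->
  rational Q -> mx_invertible (map_mx epsL Q) -> mx_invertible Q.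
Proof.
move=> i_inv epsLi [n [c [f [s [g [t [es st ts ->]]]]]]] inv.
have mapL m' n' (M : 'M[R]_(m', n')) : map_mx epsL (map_mx i M) = map_mx eps M.
  by apply/matrixP=> j k; rewrite !mxE epsLi.
apply/(mx_invertible_schur _ _ _ st ts).
rewrite -map_mxN -map_block_mx; apply: i_inv.
rewrite /eps_invertible map_block_mx map_mxN.
apply/(@mx_invertible_schur _ _ _ _ _ _ _ _ (map_mx epsL t)).
- by rewrite -mapL -map_mxM st map_mx1.
- by rewrite -mapL -map_mxM ts map_mx1.
by move: inv; rewrite map_mxD !map_mxM !mapL.
Qed.

End Rational.

(** * Homomorphisms out of the free algebra and the free group ring *)

Section Generation.
Variables (A : pzRingType) (n : nat).

Lemma free_alg_gen_ind (P : free_alg A n -> Prop) :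
  (forall p q, P p -> P q -> P (p + q)) ->
  (forall p q, P p -> P q -> P (p * q)) ->
  (forall a, P (mringC _ a)) -> (forall j, P (free_alg_var A j)) ->
  forall p, P p.
Proof.
move=> PD PM PC PX; elim/mring_ind => [|p q|a w]; last 1 first.
- have -> : mring_mon a w = mringC _ a * mring_mon 1 w :> free_alg A n.
    by rewrite mringMUU mulr1 mul1g.
  apply: (PM _ _ (PC a)); elim: w => [|j w IH]; first exact: (PC 1).
  have -> : mring_mon 1 (j :: w : free_monoid n) =
      free_alg_var A j * mring_mon 1 (w : free_monoid n) :> free_alg A n.
    by rewrite mringMUU mulr1.
  exact: PM.
- by rewrite -(rmorph0 (@mringC A (free_monoid n))); apply: PC.
exact: PD.
Qed.

Lemma free_group_gen_ind (P : free_group n -> Prop) :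
  P 1%g ->
  (forall j w, P w -> P (fg_gen j * w)%g) ->
  (forall j w, P w -> P ((fg_gen j)^-1 * w)%g) -> forall w, P w.
Proof.
move=> P1 Pgen PgenV [u ur]; elim: u ur => [|[j b] u IH] ur.
  by have -> : FreeGroup ur = 1%g by apply/val_inj.
(* No cancellation occurs when the first letter of a reduced word is put back. *)
have cons_letter (l : free_group n) : fg_word l = [:: (j, b)] ->
    FreeGroup ur = (l * FreeGroup (path_sorted ur))%g.
  move=> lE; apply/val_inj; rewrite /= lE /=.
  by case: u ur {IH} => //= c u /andP[/negPf->].
case: b ur cons_letter IH => ur cons_letter IH.
  by rewrite (cons_letter (fg_gen j)) //; apply: Pgen.
by rewrite (cons_letter (fg_gen j)^-1%g) //; apply: PgenV.
Qed.

Lemma free_group_ring_gen_ind (P : free_group_ring A n -> Prop) :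
  (forall p q, P p -> P q -> P (p + q)) ->
  (forall p q, P p -> P q -> P (p * q)) ->
  (forall a, P (mringC _ a)) -> (forall j, P (fgr_gen A j)) ->
  (forall j y, fgr_gen A j * y = 1 -> y * fgr_gen A j = 1 -> P y) ->
  forall p, P p.
Proof.
move=> PD PM PC PZ PV.
have monM (u v : free_group n) :
    mring_mon 1 (u * v)%g = mring_mon 1 u * mring_mon 1 v :> free_group_ring A n.
  by rewrite mringMUU mulr1.
elim/mring_ind => [|p q|a w]; last 1 first.
- have -> : mring_mon a w = mringC _ a * mring_mon 1 w :> free_group_ring A n.
    by rewrite mringMUU mulr1 mul1g.
  apply: (PM _ _ (PC a)); elim/free_group_gen_ind: w => [|j w IH|j w IH].
  + exact: (PC 1).
  + by rewrite monM; apply: PM (PZ j) IH.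
  by rewrite monM; apply: PM => //; apply: (PV j); rewrite -monM (mulgV, mulVg).
- by rewrite -(rmorph0 (@mringC A (free_group n))); apply: PC.
exact: PD.
Qed.

Lemma free_alg_rmorph_eq (B : pzRingType) (f g : {rmorphism free_alg A n -> B}) :
  (forall a, f (mringC _ a) = g (mringC _ a)) ->
  (forall j, f (free_alg_var A j) = g (free_alg_var A j)) -> f =1 g.
Proof.
move=> fgC fgX; elim/free_alg_gen_ind => // p q fgp fgq.
  by rewrite !rmorphD fgp fgq.
by rewrite !rmorphM fgp fgq.
Qed.

(** Agreement on the generators forces agreement on their inverses, because
two-sided inverses in B are unique. *)
Lemma free_group_ring_rmorph_eq (B : pzRingType)
    (f g : {rmorphism free_group_ring A n -> B}) :
  (forall a, f (mringC _ a) = g (mringC _ a)) ->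
  (forall j, f (fgr_gen A j) = g (fgr_gen A j)) -> f =1 g.
Proof.
move=> fgC fgZ; elim/free_group_ring_gen_ind => // [p q fgp fgq|p q fgp fgq|j y zy yz].
- by rewrite !rmorphD fgp fgq.
- by rewrite !rmorphM fgp fgq.
rewrite -[f y]mulr1 -(rmorph1 g) -zy rmorphM -fgZ mulrA.
by rewrite -rmorphM yz rmorph1 mul1r.
Qed.

End Generation.

Section FreeGroupRingExtension.
Variables (A B : pzRingType) (n : nat) (f : {rmorphism A -> B}).
Variables u v : 'I_n -> B.
Hypotheses (uv : forall j, u j * v j = 1) (vu : forall j, v j * u j = 1).
Hypothesis fuC : forall a j, GRing.comm (f a) (u j).

Definition letter_val (l : letter n) : B := if l.2 then u l.1 else v l.1.

Definition fg_val (w : free_group n) : B := \prod_(l <- fg_word w) letter_val l.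

(** Multiplication of reduced words pushes letters one at a time, and a cancelled
pair of letters has value 1. *)
Lemma fg_valM (w w' : free_group n) : fg_val (w * w')%g = fg_val w * fg_val w'.
Proof.
have valV l : letter_val l * letter_val (letterV l) = 1.
  by case: l => j []; rewrite /letter_val /= ?uv ?vu.
have val_push l r : \prod_(k <- push l r) letter_val k =
    letter_val l * \prod_(k <- r) letter_val k.
  case: r => [|k r] /=; first by rewrite big_seq1 big_nil mulr1.
  case: eqP => [->|_]; last by rewrite big_cons.
  by rewrite big_cons mulrA valV mul1r.
rewrite /fg_val /=; elim: (fg_word w) => [|l r IH] /=.
  by rewrite big_nil mul1r.
by rewrite val_push IH big_cons mulrA.
Qed.

Lemma fg_val_comm a w : GRing.comm (f a) (fg_val w).
Proof.
have fvC j : GRing.comm (f a) (v j).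
  rewrite /GRing.comm -[f a * v j]mul1r -{1}(vu j) -!mulrA (mulrA (u j)).
  by rewrite -(fuC a j) -(mulrA (f a)) uv mulr1.
rewrite /fg_val; elim/big_rec: _ => [|[j b] x _ IH]; first exact: commr1.
by apply: commrM => //; case: b; [exact: fuC | exact: fvC].
Qed.

Lemma free_group_ring_extension :
  exists g : {rmorphism free_group_ring A n -> B},
    (forall a, g (mringC _ a) = f a) /\ (forall j, g (fgr_gen A j) = u j).
Proof.
have fg_val1 : fg_val 1%g = 1 by rewrite /fg_val big_nil.
pose G := mring_ext f fg_val : free_group_ring A n -> B.
pose Gz := GRing.isZmodMorphism.Build _ _ G (mring_extB f fg_val).
pose Gm := GRing.isMonoidMorphism.Build _ _ G
  (mring_extM fg_val1 fg_valM fg_val_comm).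
pose g : {rmorphism free_group_ring A n -> B} := HB.pack G Gz Gm.
have gE a w : g (mring_mon a w) = f a * fg_val w by apply: mring_extU.
exists g; split=> [a|j]; first by rewrite gE fg_val1 mulr1.
by rewrite gE rmorph1 mul1r /fg_val big_seq1.
Qed.

End FreeGroupRingExtension.

(** * The comparison map and its inverse *)

(** Both e and the identity factor the universal map through itself. *)
Lemma cohn_endo_id (R : pzRingType) (S : mx_set R) (L : pzRingType)
    (i : {rmorphism R -> L}) (hL : is_cohn_localization S i)
    (e : {rmorphism L -> L}) :
  (forall r, e (i r) = i r) -> e =1 id.
Proof.
move=> ei s; have [g [_ g_uniq]] := cohn_universal hL (cohn_inverting hL).
by rewrite (g_uniq e ei) -(g_uniq idfun).
Qed.

Section Comparison.
Variables (A : pzRingType) (n : nat).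

(** For a rectangular M, the square matrices M N' and N' M have augmentation 1,
so their images are invertible; this makes the image of M invertible on both
sides. *)
Lemma magnus_inverting (P : pzRingType) (i : {rmorphism free_group_ring A n -> P}) :
  mx_inverting (@Psi_set A n) i ->
  mx_inverting (@Sigma_set A n) (i \o @magnus_map A n).
Proof.
move=> i_inv p q M [N [MN NM]].
pose im : {rmorphism free_alg A n -> P} := i \o @magnus_map A n.
have sq_inv k (K : 'M[free_alg A n]_k) :
    map_mx (@free_alg_eps A n) K = 1%:M -> mx_invertible (map_mx im K).
  move=> K1; rewrite map_mx_comp; apply: i_inv; split=> //.
  rewrite -map_mx_comp (eq_map_mx _ (@free_group_ring_eps_magnus A n)) K1.
  exact: mx_invertible1.
pose N' : 'M[free_alg A n]_(q, p) := map_mx (@mringC A (free_monoid n)) N.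
have epsN' : map_mx (@free_alg_eps A n) N' = N.
  by apply/matrixP=> j k; rewrite !mxE free_alg_epsC.
have [|U [MN'U _]] := sq_inv _ (M *m N'); first by rewrite map_mxM epsN'.
have [|V [_ VN'M]] := sq_inv _ (N' *m M); first by rewrite map_mxM epsN'.
rewrite map_mxM -mulmxA in MN'U; rewrite map_mxM mulmxA in VN'M.
exact: mx_invertible_lr MN'U VN'M.
Qed.

Section Extension.
Variables (L : pzRingType) (i : {rmorphism free_alg A n -> L}).

Lemma free_alg_eps_1X (j : 'I_n) : free_alg_eps (1 + free_alg_var A j) = 1.
Proof. by rewrite rmorphD rmorph1 /= free_alg_epsX addr0. Qed.

Lemma magnus_extension :
  mx_inverting (@Sigma_set A n) i ->
  exists k : {rmorphism free_group_ring A n -> L},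
    forall p, k (magnus_map p) = i p.
Proof.
move=> i_inv; pose u j : L := i (1 + free_alg_var A j).
have [v uvP] : exists v : 'I_n -> L, forall j, u j * v j = 1 /\ v j * u j = 1.
  apply: (@fin_all_exists _ _ (fun j y => u j * y = 1 /\ y * u j = 1)) => j.
  have [|V] := i_inv _ _ ((1 + free_alg_var A j)%:M : 'M_1).
    rewrite /Sigma_set map_scalar_mx /= free_alg_eps_1X.
    exact: mx_invertible1.
  rewrite map_scalar_mx [V]mx11_scalar -!scalar_mxM => -[uV Vu].
  exists (V 0 0); split.
    by move/matrixP/(_ 0 0): uV; rewrite !mxE.
  by move/matrixP/(_ 0 0): Vu; rewrite !mxE.
have [uv vu] : (forall j, u j * v j = 1) /\ (forall j, v j * u j = 1).
  by split=> j; case: (uvP j).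
pose iC : {rmorphism A -> L} := i \o @mringC A (free_monoid n).
have iuC a j : GRing.comm (iC a) (u j).
  rewrite /GRing.comm /= -!rmorphM; congr (i _).
  by apply: commrD; [exact: commr1 | exact: mringC_comm].
have [k [kC kZ]] := free_group_ring_extension uv vu iuC.
exists k => p.
apply: (@free_alg_rmorph_eq _ _ _ (k \o @magnus_map A n) i) p => [a|j] /=.
  by rewrite magnus_mapC kC.
by rewrite magnus_mapX rmorphB rmorph1 kZ /u rmorphD rmorph1 addrC addKr.
Qed.

Variable k : {rmorphism free_group_ring A n -> L}.
Hypothesis k_magnus : forall p, k (magnus_map p) = i p.

Lemma magnus_extensionC a : k (mringC _ a) = i (mringC _ a).
Proof. by rewrite -magnus_mapC k_magnus. Qed.

Lemma magnus_extensionZ j : k (fgr_gen A j) = i (1 + free_alg_var A j).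
Proof.
by rewrite -k_magnus rmorphD rmorph1 /= magnus_mapX addrC subrK.
Qed.

Lemma magnus_extension_rational p q (M : 'M[free_group_ring A n]_(p, q)) :
  rational (@free_alg_eps A n) i (map_mx k M).
Proof.
apply: rational_entries => j l; rewrite mxE; move: (M j l).
elim/free_group_ring_gen_ind => [x y ratx raty|x y ratx raty|a|m|m y zy yz].
- by rewrite rmorphD raddfD; apply: rationalD.
- by rewrite rmorphM scalar_mxM; apply: rationalM.
- by rewrite magnus_extensionC -map_scalar_mx; apply: rational_map.
- by rewrite magnus_extensionZ -map_scalar_mx; apply: rational_map.
apply: (rationalV (a := 1 + free_alg_var A m)).
- by exists 1; rewrite /= free_alg_eps_1X mulr1.
- by rewrite -magnus_extensionZ -rmorphM zy rmorph1.
by rewrite -magnus_extensionZ -rmorphM yz rmorph1.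
Qed.

Lemma magnus_extension_inverting :
  is_cohn_localization (@Sigma_set A n) i -> mx_inverting (@Psi_set A n) k.
Proof.
move=> [i_inv i_univ] p q M [_ Minv].
(* The augmentation inverts Sigma by definition, so it extends to L. *)
have [epsL [epsLi _]] := i_univ A (@free_alg_eps A n) (fun _ _ _ h => h).
have epsLk : epsL \o k =1 @free_group_ring_eps A n.
  apply: free_group_ring_rmorph_eq => [a|j] /=.
    by rewrite magnus_extensionC epsLi /= free_alg_epsC free_group_ring_epsC.
  by rewrite magnus_extensionZ epsLi /= free_alg_eps_1X free_group_ring_epsZ.
apply: (rational_invertible i_inv epsLi (magnus_extension_rational M)).
by rewrite -map_mx_comp (eq_map_mx _ epsLk).
Qed.

End Extension.

End Comparison.

Theorem proposition5p1 (A : pzRingType) (mu : nat)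
    (SigmaAX PsiAF : pzRingType)
    (i_Sigma : {rmorphism free_alg A mu -> SigmaAX})
    (i_Psi : {rmorphism free_group_ring A mu -> PsiAF})
    (hSigma : is_cohn_localization (@Sigma_set A mu) i_Sigma)
    (hPsi : is_cohn_localization (@Psi_set A mu) i_Psi) :
  exists m : {rmorphism SigmaAX -> PsiAF},
    (forall p : free_alg A mu, m (i_Sigma p) = i_Psi (magnus_map p)) /\
    (forall m' : {rmorphism SigmaAX -> PsiAF},
       (forall p : free_alg A mu, m' (i_Sigma p) = i_Psi (magnus_map p)) ->
       forall s : SigmaAX, m' s = m s) /\
    bijective m.
Proof.
have [m [mE m_uniq]] := cohn_universal hSigma
  (f := i_Psi \o @magnus_map A mu) (magnus_inverting (cohn_inverting hPsi)).
have [k k_magnus] := magnus_extension (cohn_inverting hSigma).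
have [kbar [kbarE _]] :=
  cohn_universal hPsi (magnus_extension_inverting k_magnus hSigma).
have mk : m \o k =1 i_Psi.
  apply: free_group_ring_rmorph_eq => [a|j] /=.
    by rewrite (magnus_extensionC k_magnus) mE /= magnus_mapC.
  rewrite (magnus_extensionZ k_magnus) mE /= rmorphD rmorph1 /= magnus_mapX.
  by rewrite addrC subrK.
exists m; split; first exact: mE.
split; first exact: m_uniq.
exists kbar => s.
  apply: (cohn_endo_id hSigma (e := kbar \o m)) => p /=.
  by rewrite mE kbarE k_magnus.
apply: (cohn_endo_id hPsi (e := m \o kbar)) => x /=.
by rewrite kbarE; apply: mk.
Qed.
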